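(* Let $N$ nodes with utilities $U(i)$ be given and let $(p_t)_{t\ge 0}$ be real numbers with $0<Np_t<1$ for all $t$. The graph generated by Algorithm 1 with sampling probabilities $p_t$ (see context), run from any given initial graph, converges to a gradient topology with probability $1$, in the sense that almost surely $\lim_{t\to\infty}X_t^{(i)}=1$ for every node $i$, if and only if $$\lim_{T\to\infty}\prod_{t=0}^{T}(1-p_t)=0 .$$
   Context: Nodes: $\mathcal N=\{1,\dots,N\}$; each node $i$ has a fixed utility $U(i)\in\{1,\dots,n\}$. Put $m_u=|\{i:U(i)=u\}|$ and $d(i,j)=|U(i)-U(j)|$. At each time $t=0,1,2,\dots$ each node $i$ with $U(i)=u$ has a similar view $N_i^s(t)\subseteq\mathcal N\setminus\{i\}$ with exactly $m_u$ elements (it is assumed that this is possible, i.e. $m_u\le N-1$ for all $u$ that occur as utilities). The directed graph at time $t$ has edges from $i$ to the elements of $N_i^s(t)$; the initial graph is given by the views $N_i^s(0)$, on which no further condition is imposed. Algorithm 1 with sampling probabilities $p_t$: at time $t$, each node $i$ draws a random view which equals $\{j\}$ with probability $p_t$ for each $j\in\mathcal N$ and is empty with probability $1-Np_t$; draws at different times and by different nodes are independent. If the random view is empty, or if $j=i$ or $j\in N_i^s(t)$, then $N_i^s(t+1)=N_i^s(t)$. Otherwise, if $U(j)\ge U(i)$ and $d(i,j)\le\max_{k\in N_i^s(t)}d(i,k)$, then $N_i^s(t+1)$ is obtained from $N_i^s(t)$ by adding $j$ and removing an element of $N_i^s(t)$ that maximizes $d(i,\cdot)$ over $N_i^s(t)$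 (ties broken by any fixed deterministic rule); if these conditions fail, $N_i^s(t+1)=N_i^s(t)$. $X_t^{(i)}$ is the number of $j\in N_i^s(t)$ with $U(j)\ne U(i)$. (Since only $m_u-1$ other nodes share the utility $u=U(i)$, always $X_t^{(i)}\ge 1$. The dynamics satisfy $\mathcal P\{X_{t+1}^{(i)}=k\mid X_t^{(i)}=k+1\}=kp_t$, and otherwise $X^{(i)}$ does not change at that step.)
   Formalization: The ''only if'' direction is proved only for initial graphs that are not already a gradient topology (some X_0^(i) ≠ 1), since otherwise X stays 1 for any p_t and the claim fails (e.g. N=2 with distinct utilities); the ''if'' direction holds for every initial graph. *)

(* Defs.v *)
From HB Require Import structures.
From mathcomp Require Import all_boot all_order all_algebra.
From mathcomp Require Import all_classical all_reals all_analysis.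
Set Implicit Arguments.
Unset Strict Implicit.
Unset Printing Implicit Defensive.
Import Order.TTheory GRing.Theory Num.Theory.
Import numFieldNormedType.Exports.
Local Open Scope classical_set_scope.
Local Open Scope ring_scope.

Section Algorithm.
Variables (N : nat) (U : 'I_N -> nat).

Definition multiplicity (u : nat) : nat := #|[set i : 'I_N | U i == u]%SET|.

Definition udist (i j : 'I_N) : nat := `|(U i)%:Z - (U j)%:Z|%N.

(* A directed graph is given by the similar view of each node. *)
Definition graph := 'I_N -> {set 'I_N}.

Definition admissible (g : graph) : Prop :=
  forall i, i \notin g i /\ #|g i| = multiplicity (U i).

(* [worst i S] is the element that node [i] evicts from its view [S]: a
   maximizer of the distance to [i], ties being broken in an arbitrary but
   fixed way. *)
Definition eviction_rule (worst : 'I_N -> {set 'I_N} -> 'I_N) : Prop :=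
  forall (i : 'I_N) (S : {set 'I_N}), S != finset.set0 ->
    worst i S \in S /\
    forall k, k \in S -> (udist i k <= udist i (worst i S))%N.

Variable worst : 'I_N -> {set 'I_N} -> 'I_N.

(* The random view is [None] when empty and [Some j] when equal to {j}. *)
Definition update (i : 'I_N) (S : {set 'I_N}) (view : option 'I_N) :
    {set 'I_N} :=
  if view is Some j then
    if (j == i) || (j \in S) then S
    else if (U i <= U j)%N && (udist i j <= \max_(k in S) udist i k)%N
    then (j |: (S :\ worst i S))%SET
    else S
  else S.

Fixpoint similar_view (g0 : graph) (view : nat -> 'I_N -> option 'I_N)
    (t : nat) : graph :=
  if t is t'.+1
  then fun i => update i (similar_view g0 view t' i) (view t' i)
  else g0.

Definition dissimilar (g : graph) (i : 'I_N) : nat :=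
  #|[set j in g i | U j != U i]%SET|.

Definition gradient_topology (g : graph) : Prop :=
  forall i, dissimilar g i = 1%N.

End Algorithm.

Section Randomness.
Context {d : measure_display} {Omega : measurableType d} {R : realType}.
Variable P : probability Omega R.

Definition discrete_random_variable (T : Type) (X : Omega -> T) : Prop :=
  forall A : set T, measurable (X @^-1` A).

(* Mutual independence of a family of discrete random variables: every set
   of values is an event, so the product rule ranges over all of them. *)
Definition mutually_independent (I : eqType) (T : Type)
    (X : I -> Omega -> T) : Prop :=
  forall (s : seq I) (A : I -> set T), uniq s ->
    P (\bigcap_(k in [set` s]) (X k @^-1` A k)) =
    (\prod_(k <- s) P (X k @^-1` A k))%E.

Definition random_views (N : nat) (p : nat -> R)
    (view : nat -> 'I_N -> Omega -> option 'I_N) : Prop :=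
  [/\ forall t i, discrete_random_variable (view t i),
      forall t i j, P (view t i @^-1` [set Some j]) = (p t)%:E,
      forall t i, P (view t i @^-1` [set None]) = (1 - N%:R * p t)%:E &
      mutually_independent (fun ti : nat * 'I_N => view ti.1 ti.2)].

Definition converges_to_gradient (N : nat) (U : 'I_N -> nat)
    (worst : 'I_N -> {set 'I_N} -> 'I_N) (g0 : graph N)
    (view : nat -> 'I_N -> Omega -> option 'I_N) : Prop :=
  {ae P, forall w, forall i,
    (fun t => (dissimilar U
       (similar_view U worst g0 (fun s k => view s k w) t) i)%:R : R)
      @ \oo --> (1 : R)}.

End Randomness.

(* Main.v *)
(** Let [M i] be the set of nodes that share the utility of [i], differ from
    [i], and are absent from its current view.  Counting gives
    [X^(i) = 1 + #|M i|], so every view contains a dissimilar node, the evicted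
    node is always dissimilar, and a node leaves [M i] exactly when it is first
    drawn by [i], never to return.  Hence [X^(i)] tends to 1 iff every node
    initially in [M i] is eventually drawn by [i]; by independence, a given
    node is not drawn before time [T] with probability
    [\prod_(t < T) (1 - p t)]. *)
Require Import Defs.
From HB Require Import structures.
From mathcomp Require Import all_boot all_order all_algebra.
From mathcomp Require Import all_classical all_reals all_analysis.
Import Order.TTheory GRing.Theory Num.Theory.
Import numFieldNormedType.Exports.
Local Open Scope classical_set_scope.
Local Open Scope ring_scope.

Definition missing {N : nat} (U : 'I_N -> nat) (i : 'I_N) (S : {set 'I_N}) :
    {set 'I_N} :=
  [set j | [&& U j == U i, j != i & j \notin S]]%SET.

Definition never_drawn {Omega : Type} {N : nat}
    (view : nat -> 'I_N -> Omega -> option 'I_N) (i j : 'I_N) (T : nat) :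
    set Omega :=
  [set w | forall t, (t < T)%N -> view t i w <> Some j].

Section SimilarView.
Context {N : nat} {U : 'I_N -> nat}.
Implicit Types (i j k : 'I_N) (S : {set 'I_N}).

Lemma udist_eq0 i j : (udist U i j == 0%N) = (U i == U j).
Proof. by rewrite /udist absz_eq0 subr_eq0 eqz_nat. Qed.

(** [S] and the utility class of [i] have equal size, so cancelling their common part leaves equally
    many nodes on both sides; what is left of the class is [missing U i S] together with [i] itself,
    hence the successor. *)
Lemma card_dissimilar i S :
  i \notin S -> #|S| = multiplicity U (U i) ->
  #|[set j in S | U j != U i]%SET| = #|missing U i S|.+1.
Proof.
move=> iS cS.
have split_S := cardsID [set j | U j == U i]%SET S.
have split_class := cardsID (i |: S)%SET [set j | U j == U i]%SET.
have class_in : #|[set j | U j == U i] :&: (i |: S)|%SET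
    = #|S :&: [set j | U j == U i]|%SET.+1.
  have -> : ([set j | U j == U i] :&: (i |: S))%SET
      = (i |: (S :&: [set j | U j == U i]))%SET.
    by apply/setP => j; rewrite !inE; case: (eqVneq j i) => [->|_];
      rewrite ?eqxx // andbC.
  by rewrite cardsU1 !inE (negbTE iS).
have class_out : ([set j | U j == U i] :\: (i |: S))%SET = missing U i S.
  by apply/setP => j; rewrite !inE negb_or andbC andbA.
have diss : (S :\: [set j | U j == U i])%SET = [set j in S | U j != U i]%SET.
  by apply/setP => j; rewrite !inE andbC.
rewrite class_in class_out in split_class; rewrite diss in split_S.
apply: (addnI (etrans split_S (etrans cS _))).
by rewrite addnS -addSn split_class.
Qed.

Context {worst : 'I_N -> {set 'I_N} -> 'I_N} (worstP : eviction_rule U worst).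

(** By the count above, [S] has a member at positive distance from [i], so a maximizer of the
    distance is at positive distance too. *)
Lemma worst_dissimilar i S :
  i \notin S -> #|S| = multiplicity U (U i) ->
  worst i S \in S /\ U (worst i S) != U i.
Proof.
move=> iS cS.
have /card_gt0P[k] : (0 < #|[set j in S | U j != U i]%SET|)%N.
  by rewrite card_dissimilar.
rewrite !inE => /andP[kS Uk].
have [wS wmax] := worstP i S (introT (finset.set0Pn _) (ex_intro _ k kS)).
split=> //; have := wmax k kS.
by apply: contraTN => Uw; rewrite -ltnNge (eqP (_ : udist U i _ == 0%N));
  rewrite ?lt0n udist_eq0 // eq_sym.
Qed.

Lemma update_admissible i S v :
  i \notin S -> #|S| = multiplicity U (U i) ->
  i \notin update U worst i S v /\
  #|update U worst i S v| = multiplicity U (U i).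
Proof.
move=> iS cS; case: v => [j|] //=.
case: ifP => // /norP[ji jS]; case: ifP => // _.
have [wS _] := worst_dissimilar i S iS cS.
split; first by rewrite !inE eq_sym (negbTE ji) (negbTE iS) andbF.
by rewrite cardsU1 !inE (negbTE jS) andbF /= -cS (cardsD1 (worst i S) S) wS.
Qed.

(** Eviction spares the utility class of [i], so nothing becomes missing again; a missing node that
    is drawn has distance 0 and passes the acceptance test. *)
Lemma missing_update i S v j :
  i \notin S -> #|S| = multiplicity U (U i) ->
  (j \in missing U i (update U worst i S v)) =
  (j \in missing U i S) && (v != Some j).
Proof.
move=> iS cS; case: v => [k|] /=; last by rewrite andbT.
have [wS Uw] := worst_dissimilar i S iS cS.
rewrite (inj_eq Some_inj) !inE.
case: (eqVneq (U j) (U i)) => //= Uj; case: (eqVneq j i) => //= ji.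
have wj : (j == worst i S) = false.
  by apply: contra_neqF Uw => /eqP <-.
case: ifP => [/orP[/eqP->|kS]|/norP[ki kS]].
- by rewrite eq_sym ji andbT.
- case: (eqVneq k j) => [<-|]; last by rewrite andbT.
  by rewrite kS.
case: ifP => [_|].
  by rewrite !inE wj negb_or eq_sym andbC.
case: (eqVneq k j) => [->|]; last by rewrite andbT.
by rewrite Uj leqnn /= (eqP (_ : udist U i j == 0%N)) // udist_eq0 Uj.
Qed.

Context {g0 : graph N} (g0_adm : admissible U g0).
Variable view : nat -> 'I_N -> option 'I_N.

Lemma similar_view_admissible t : admissible U (similar_view U worst g0 view t).
Proof.
by elim: t => //= t IHt i; have [? ?] := IHt i; apply: update_admissible.
Qed.

Lemma dissimilar_similar_view t i :
  dissimilar U (similar_view U worst g0 view t) i =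
  #|missing U i (similar_view U worst g0 view t i)|.+1.
Proof. by have [? ?] := similar_view_admissible t i; apply: card_dissimilar. Qed.

Lemma missing_similar_view t i j :
  j \in missing U i (similar_view U worst g0 view t i) <->
  j \in missing U i (g0 i) /\ forall s, (s < t)%N -> view s i <> Some j.
Proof.
elim: t => [|t IHt] /=; first by split=> [|[]].
have [iS cS] := similar_view_admissible t i.
rewrite missing_update //; split.
  move=> /andP[/IHt[jM nd] /eqP vj]; split=> // s.
  by rewrite ltnS leq_eqVlt => /orP[/eqP->|/nd].
move=> [jM nd]; apply/andP; split; last by apply/eqP/nd.
by apply/IHt; split=> // s st; apply/nd/ltnW.
Qed.

Lemma cvg_dissimilar (R : realType) i :
  (fun t => (dissimilar U (similar_view U worst g0 view t) i)%:R : R)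
    @ \oo --> (1 : R) <->
  forall j, j \in missing U i (g0 i) -> exists t, view t i = Some j.
Proof.
split=> [X1 j jM|drawn].
  (* A single time at which the count is within 1 of its limit suffices: there the number of missing
     nodes is a natural number below 1. *)
  have [T _ near1] : \forall t \near \oo,
      `|1 - (dissimilar U (similar_view U worst g0 view t) i)%:R| < 1 :> R.
    by move/cvgr_dist_lt : X1; apply.
  have := near1 T (leqnn T); rewrite /= dissimilar_similar_view -natr1.
  rewrite opprD addrCA subrr addr0 normrN normr_nat -[ltRHS]/(1%:R) ltr_nat.
  rewrite ltnS leqn0 cards_eq0 => /eqP M0.
  apply: contrapT => /forallNP nd.
  suff : j \in finset.set0 by rewrite inE.
  by rewrite -M0; apply/missing_similar_view; split=> // s _; exact: nd.
(* [tau j] is a time at which [j] is drawn, with dummy value 0 for nodes not missing initially. Past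
   all of these times the count is constantly 1. *)
have /choice[tau tauP] j : exists t, j \in missing U i (g0 i) ->
    view t i = Some j.
  case: (boolP (j \in missing U i (g0 i))) => [/drawn[t vt]|_].
    by exists t.
  by exists 0%N.
apply: cvg_near_cst; exists (\max_j (tau j).+1)%N => //= t /= tau_t.
rewrite dissimilar_similar_view (_ : missing U i _ = finset.set0) ?cards0 //.
apply/setP => j; rewrite [RHS]inE; apply/negP => /missing_similar_view[jM nd].
apply: (nd (tau j)) (tauP j jM); apply: leq_trans tau_t.
exact: (leq_bigmax j).
Qed.

End SimilarView.

Lemma ngradient_missing (N : nat) (U : 'I_N -> nat) (g : graph N) :
  admissible U g -> ~ gradient_topology U g ->
  exists i j, j \in missing U i (g i).
Proof.
move=> g_adm /existsNP[i Xi]; exists i; have [iS cS] := g_adm i.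
apply/finset.set0Pn; apply: contra_notN Xi => /eqP M0.
by rewrite /dissimilar card_dissimilar // M0 cards0.
Qed.

Section NeverDrawn.
Context {d : measure_display} {Omega : measurableType d} {R : realType}
  {P : probability Omega R} {N : nat} {p : nat -> R}
  {view : nat -> 'I_N -> Omega -> option 'I_N} (viewP : random_views P p view).

(** Brings the event into the shape required by the product rule of [mutually_independent]. *)
Lemma never_drawnE i j T :
  never_drawn view i j T =
  \bigcap_(ti in [set` [seq (t, i) | t <- iota 0 T]])
    (view ti.1 ti.2 @^-1` ~` [set Some j]).
Proof.
apply/seteqP; split=> w nd.
  by move=> _ /= /mapP[t + ->]; rewrite mem_iota => tT; apply: nd.
move=> t tT; apply: (nd (t, i)) => /=; apply: map_f.
by rewrite mem_iota.
Qed.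

Lemma measurable_never_drawn i j T :
  measurable (never_drawn view i j T).
Proof.
have [mv _ _ _] := viewP.
by rewrite never_drawnE; apply: fin_bigcap_measurable => // *; apply: mv.
Qed.

Lemma probability_never_drawn i j T :
  P (never_drawn view i j T) = (\prod_(0 <= t < T) (1 - p t))%:E.
Proof.
have [mv pv _ indep] := viewP.
rewrite never_drawnE (indep _ (fun=> ~` [set Some j])); last first.
  by rewrite map_inj_uniq ?iota_uniq // => s t [].
rewrite big_map -prodEFin /index_iota subn0; apply: eq_bigr => t _ /=.
by rewrite -preimage_setC probability_setC ?pv //; apply: mv.
Qed.

Lemma never_drawn_nonincreasing i j :
  nonincreasing_seq (never_drawn view i j).
Proof.
by move=> s t st; apply/subsetPset => w nd r rs; apply/nd/(leq_trans rs).
Qed.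

(** Continuity from above: the events decrease in [T], so the probability of their intersection is
    the limit of the products. *)
Lemma negligible_never_drawn i j :
  P.-negligible (\bigcap_T never_drawn view i j T) <->
  (fun T : nat => \prod_(0 <= t < T.+1) (1 - p t)) @ \oo --> (0 : R).
Proof.
have mND := measurable_never_drawn i j.
have mcap : measurable (\bigcap_T never_drawn view i j T).
  exact: bigcapT_measurable.
have P0 : (P (never_drawn view i j 0) < +oo)%E.
  by rewrite probability_never_drawn ltry.
have := nonincreasing_cvg_mu P0 mND mcap (never_drawn_nonincreasing i j).
have -> : P \o never_drawn view i j
    = EFin \o (fun T => \prod_(0 <= t < T) (1 - p t)).
  by apply/funext => T /=; apply: probability_never_drawn.
(* The product through index [T] is the probability at [T.+1]; the shift keeps the limit. *)
rewrite (cvg_shiftS (fun T => \prod_(0 <= t < T) (1 - p t))) => cvgP.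
rewrite negligibleP //; split=> [Pcap|cvg0].
  by move: cvgP; rewrite Pcap => /fine_cvg.
have cvg0E : (EFin \o (fun T => \prod_(0 <= t < T) (1 - p t))) @ \oo --> 0%E.
  by apply: cvg_EFin => //; exact: nearW.
exact: cvg_unique cvgP cvg0E.
Qed.

End NeverDrawn.

(** From an initial gradient topology the counts stay at 1 whatever the product does, so the
    equivalence is stated for the other initial graphs and the sufficiency for all. *)
Theorem theorem4p1 (d : measure_display) (Omega : measurableType d)
    (R : realType) (P : probability Omega R)
    (N n : nat) (U : 'I_N -> nat)
    (U_range : forall i, (1 <= U i <= n)%N)
    (U_feasible : forall i, (multiplicity U (U i) <= N - 1)%N)
    (worst : 'I_N -> {set 'I_N} -> 'I_N) (worstP : eviction_rule U worst)
    (p : nat -> R) (p_range : forall t, 0 < N%:R * p t < 1)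
    (view : nat -> 'I_N -> Omega -> option 'I_N)
    (viewP : random_views P p view)
    (g0 : graph N) (g0_adm : admissible U g0) :
  (~ gradient_topology U g0 ->
    (converges_to_gradient P U worst g0 view <->
     (fun T : nat => \prod_(0 <= t < T.+1) (1 - p t)) @ \oo --> (0 : R))) /\
  ((fun T : nat => \prod_(0 <= t < T.+1) (1 - p t)) @ \oo --> (0 : R) ->
    converges_to_gradient P U worst g0 view).
Proof.
have cvg_dissP w i := cvg_dissimilar worstP g0_adm (fun s k => view s k w) R i.
have cvg_gradient :
    (fun T : nat => \prod_(0 <= t < T.+1) (1 - p t)) @ \oo --> (0 : R) ->
    converges_to_gradient P U worst g0 view.
  (* There are finitely many pairs of nodes, so almost sure drawing may be shown for each pair
     separately. *)
  move=> cvg0; apply: filter_forall => i.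
  suff ae_drawn : {ae P, forall w, forall j, exists t, view t i w = Some j}.
    by apply: filterS ae_drawn => w drawn; apply/cvg_dissP => j _; exact: drawn.
  apply: filter_forall => j; apply: negligibleS
    ((negligible_never_drawn viewP i j).2 cvg0) => w /forallNP nd T _ t _.
  exact: nd.
split=> // /(ngradient_missing _ _ _ g0_adm)[i [j jM]].
split=> // ae_cvg; apply/(negligible_never_drawn viewP i j).
(* If [i] never draws the initially missing [j], convergence fails; a draw at time [t] is excluded
   by the event at [t.+1]. *)
apply: negligibleS ae_cvg => w nd /(_ i)/cvg_dissP/(_ j jM)[t].
exact: (nd t.+1 I t).
Qed.
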